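(* Let $X$ be an isotropic log-concave random vector in $\mathbb R^n$ verifying the variance conjecture with constant $C_1$, i.e. $\operatorname{Var}|X|^2\le C_1\lambda_X^2\,\mathbb E|X|^2$, and let $T\in GL(n)$. There exists an absolute constant $C$ such that the measure of the set of orthogonal operators $U\in O(n)$ for which the random vector $T\circ U(X)$ verifies the variance conjecture with constant $CC_1$, i.e. $$\operatorname{Var}|T\circ U(X)|^2\le C\,C_1\,\lambda_{T\circ U(X)}^2\,\mathbb E|T\circ U(X)|^2,$$ is greater than $\frac12$.
   Context: A random vector $X$ in $\mathbb R^n$ is log-concave if it has a density $e^{-V}$ with respect to Lebesgue measure, for some convex $V:\mathbb R^n\to(-\infty,\infty]$. It is isotropic if $\mathbb EX=0$ and $\mathbb E\langle X,e_i\rangle\langle X,e_j\rangle=\delta_{i,j}$ for all $1\le i,j\le n$, where $\{e_i\}$ is the canonical basis. $|\cdot|$ is the Euclidean norm and $S^{n-1}$ the Euclidean unit sphere. For a centered random vector $Z$ in $\mathbb R^n$, $\lambda_Z^2=\sup_{\xi\in S^{n-1}}\mathbb E\langle Z,\xi\rangle^2$. The measure on the orthogonal group $O(n)$ is Haar probability measure. For fixed $U$, variance and expectation are taken with respect to $X$. ''Absolute constant'' means a positive number independent of $n$, $X$, $T$ and $C_1$.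
   Formalization: The constant C_1 is assumed to be at least 1; for arbitrarily small C_1 the claim fails, e.g. for X uniform on a ball of radius sqrt(n+2), C_1 = 4/(n+4), and T close to a rank-one operator. *)

(* Defs.v *)
From HB Require Import structures.
From mathcomp Require Import all_boot all_order all_algebra.
From mathcomp Require Import all_classical all_reals all_analysis.
From mathcomp Require Import measurable_realfun.

Set Implicit Arguments.
Unset Strict Implicit.
Unset Printing Implicit Defensive.

Import Order.TTheory GRing.Theory Num.Theory.
Import numFieldNormedType.Exports.

Local Open Scope classical_set_scope.
Local Open Scope ring_scope.

Definition measure_matrix_display : measure_display.
Proof. exact: default_measure_display. Qed.

(* The sigma-algebra generated by the entries, i.e. the Borel sigma-algebra
   of the finite-dimensional space 'M[R]_(m, n).  It serves both for vectors
   (column matrices 'cV[R]_n stand for R^n) and for operators. *)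
Definition entry_preimages (R : realType) (m n : nat) :
    set (set 'M[R]_(m, n)) :=
  [set A | exists i j (B : set R),
     measurable B /\ A = (fun M : 'M[R]_(m, n) => M i j) @^-1` B].

Section measurable_matrix.
Variables (R : realType) (m n : nat).

Let matrix_set0 : <<s @entry_preimages R m n >> set0.
Proof. exact: sigma_algebra0. Qed.

Let matrix_setC (A : set 'M[R]_(m, n)) :
  <<s @entry_preimages R m n >> A -> <<s @entry_preimages R m n >> (~` A).
Proof. exact: sigma_algebraC. Qed.

Let matrix_bigcup (F : (set 'M[R]_(m, n))^nat) :
  (forall i, <<s @entry_preimages R m n >> (F i)) ->
  <<s @entry_preimages R m n >> (\bigcup_i F i).
Proof. exact: sigma_algebra_bigcup. Qed.

HB.instance Definition _ :=
  @isMeasurable.Build measure_matrix_display 'M[R]_(m, n)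
    (<<s @entry_preimages R m n >>) matrix_set0 matrix_setC matrix_bigcup.

End measurable_matrix.

Lemma measurable_entry (R : realType) (m n : nat) (i : 'I_m) (j : 'I_n) :
  measurable_fun setT (fun M : 'M[R]_(m, n) => M i j).
Proof.
move=> _ B mB; rewrite setTI; apply: sub_sigma_algebra.
by exists i, j, B.
Qed.

Lemma measurable_fun_matrixP d (T : measurableType d) (R : realType)
    (m n : nat) (f : T -> 'M[R]_(m, n)) :
  (forall i j, measurable_fun setT (fun x => f x i j)) ->
  measurable_fun setT f.
Proof.
move=> mf _ A mA; rewrite setTI.
suff : <<s @entry_preimages R m n >> `<=`
    [set B | measurable (f @^-1` B)] by exact.
apply: smallest_sub.
  split=> [|B mB|F mF] /=; first by rewrite preimage_set0.
  - rewrite setTD preimage_setC; exact: measurableC.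
  - rewrite preimage_bigcup; exact: bigcupT_measurable.
move=> _ [i [j [B [mB ->]]]] /=.
by rewrite -[X in measurable X]setTI; exact: mf.
Qed.

Section lebesgue_measure_cV.
Variable R : realType.

Definition cons_cV (n : nat) (p : R * 'cV[R]_n) : 'cV[R]_n.+1 :=
  col_mx (p.1)%:M p.2.

Lemma measurable_cons_cV (n : nat) : measurable_fun setT (@cons_cV n).
Proof.
apply: measurable_fun_matrixP => i j.
rewrite (_ : (fun x => _) = fun x : R * 'cV[R]_n =>
  match fintype.split (i : 'I_(1 + n)) with
  | inl _ => x.1 | inr k => x.2 k j end); last first.
  apply/funext => x; rewrite /cons_cV !mxE; case: (fintype.split _) => // k.
  by rewrite mxE !ord1 eqxx mulr1n.
case: (fintype.split _) => [_|k]; first exact: measurable_fst.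
exact: (measurableT_comp (@measurable_entry R n 1 k j) measurable_snd).
Qed.

HB.instance Definition _ (n : nat) :=
  isMeasurableFun.Build _ _ _ _ (@cons_cV n) (@measurable_cons_cV n).

Section step.
Variables (n : nat) (mu : {measure set 'cV[R]_n -> \bar R}).

(* The image under R * R^n ~ R^n.+1 of the product of the Lebesgue measure
   of R with mu; [\x^] integrates over the second factor last, so that it is
   a measure without any assumption on mu. *)
Definition lebesgue_step : set 'cV[R]_n.+1 -> \bar R :=
  pushforward (lebesgue_measure \x^ mu)%E (@cons_cV n).

Let step0 : lebesgue_step set0 = 0%E.
Proof. by rewrite /lebesgue_step /pushforward preimage_set0 measure0. Qed.

Let step_ge0 A : (0 <= lebesgue_step A)%E.
Proof. by rewrite /lebesgue_step /pushforward; exact: measure_ge0. Qed.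

Let step_sigma_additive : semi_sigma_additive lebesgue_step.
Proof.
move=> F mF tF mUF; rewrite /lebesgue_step /pushforward preimage_bigcup.
have mp A : measurable A -> measurable (@cons_cV n @^-1` A).
  by move=> mA; rewrite -[X in measurable X]setTI; exact: measurable_cons_cV.
apply: measure_semi_sigma_additive.
- by move=> k; exact: mp.
- apply/trivIsetP => /= i j _ _ ij; rewrite -preimage_setI.
  by move/trivIsetP : tF => /(_ _ _ _ _ ij) ->//; rewrite preimage_set0.
- by rewrite -preimage_bigcup; exact: mp.
Qed.

HB.instance Definition _ := isMeasure.Build _ _ _ lebesgue_step
  step0 step_ge0 step_sigma_additive.

End step.

Fixpoint lebesgue_cV (n : nat) : {measure set 'cV[R]_n -> \bar R} :=
  match n with
  | 0 => \d_(0 : 'cV[R]_0)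
  | n'.+1 => lebesgue_step (lebesgue_cV n')
  end.

End lebesgue_measure_cV.

Section euclidean.
Variables (R : realType) (n : nat).
Implicit Types x y : 'cV[R]_n.

Definition dotcv x y : R := \sum_(i < n) x i 0 * y i 0.

Definition basis_cV (i : 'I_n) : 'cV[R]_n := delta_mx i 0.

Definition enorm x : R := Num.sqrt (dotcv x x).

Definition unit_sphere : set 'cV[R]_n := [set xi | enorm xi = 1].

Definition orthogonal_group : set 'M[R]_n := [set U | U^T *m U = 1%:M].

(* The Haar probability measure of O(n), seen as a Borel probability on
   'M[R]_n carried by O(n); these conditions determine it uniquely. *)
Definition is_haar_orthogonal (mu : probability 'M[R]_n R) : Prop :=
  mu orthogonal_group = 1%E /\
  forall (V : 'M[R]_n) (A : set 'M[R]_n),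
    orthogonal_group V -> measurable A ->
    mu [set V *m U | U in A] = mu A.

(* No issue with +oo - oo arises below since V never takes the value -oo. *)
Definition econvex (V : 'cV[R]_n -> \bar R) : Prop :=
  forall (t : R) x y, 0 <= t <= 1 ->
    (V (t *: x + (1 - t) *: y)%R <= t%:E * V x + (1 - t)%:E * V y)%E.

End euclidean.

Arguments basis_cV {R n} i.
Arguments unit_sphere {R} n.
Arguments orthogonal_group {R} n.

Section random_vectors.
Context {d : measure_display} {Omega : measurableType d} {R : realType}.
Variables (P : probability Omega R) (n : nat).

Definition log_concave (X : {RV P >-> 'cV[R]_n}) : Prop :=
  exists V : 'cV[R]_n -> \bar R,
    [/\ forall x, V x != -oo%E,
        econvex V,
        measurable_fun setT V &
        forall A : set 'cV[R]_n, measurable A ->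
          distribution P X A = (\int[lebesgue_cV R n]_(x in A) expeR (- V x))%E].

Definition isotropic (X : Omega -> 'cV[R]_n) : Prop :=
  (forall i : 'I_n, 'E_P[(fun w => dotcv (X w) (basis_cV i))%R] = 0)%E /\
  (forall i j : 'I_n,
     'E_P[(fun w => dotcv (X w) (basis_cV i) * dotcv (X w) (basis_cV j))%R] =
     ((i == j)%:R)%:E)%E.

(* lambda_Z ^ 2 for a centered Z *)
Definition lambda_sq (Z : Omega -> 'cV[R]_n) : \bar R :=
  ereal_sup
    [set ('E_P[(fun w => dotcv (Z w) xi ^+ 2)%R])%E | xi in unit_sphere n].

(* The constant is meant to be used with 1 <= C.  Small constants do occur
   for single vectors: the isotropic uniform vector X on a ball of R^n has
   constant 4 / (n + 4), but T X does not satisfy the inequality with a bounded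
   multiple of it when T is close to a rank one operator, since then
   Var |T X|^2 / (lambda_{T X}^2 E |T X|^2) is close to (2n + 2) / (n + 4). *)
Definition variance_conjecture (Z : Omega -> 'cV[R]_n) (C : R) : Prop :=
  ('V_P[(fun w => enorm (Z w) ^+ 2)%R]
   <= C%:E * lambda_sq Z * 'E_P[(fun w => enorm (Z w) ^+ 2)%R])%E.

End random_vectors.

(* Main.v *)
Require Import Defs.
From HB Require Import structures.
From mathcomp Require Import all_boot all_order all_algebra.
From mathcomp Require Import all_classical all_reals all_analysis.
From mathcomp Require Import measurable_realfun.
From mathcomp Require Import ring lra.

Set Implicit Arguments.
Unset Strict Implicit.
Unset Printing Implicit Defensive.

Import Order.TTheory GRing.Theory Num.Theory.
Import numFieldNormedType.Exports.

Local Open Scope classical_set_scope.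
Local Open Scope ring_scope.

(** Write [t] for the squared Hilbert-Schmidt norm of [T], [g] for that of
    [T T^T], and [L] for the squared operator norm of [T].  As [X] is isotropic,
    [E |T U X|^2 = t] and [lambda_{TUX}^2 = L] for every orthogonal [U], so the
    claim compares [Var |T U X|^2 = E_X (|T U X|^2 - t)^2] with a multiple of
    [C1 L t].  It suffices to bound the average over [U] of this variance by
    [3 C1 L t]: Markov's inequality then shows that it exceeds [7 C1 L t] with
    probability at most [3/7 < 1/2].

    By Tonelli's theorem the average over [U] may be taken first, with [X = x]
    fixed.  Then [U x] is rotation invariant, and its second and fourth moments
    are explicit ([haar_moment2], [haar_moment22]):
    [E <v,Ux>^2 = |v|^2 |x|^2 / n] and
    [E <v,Ux>^2 <w,Ux>^2 = |x|^4 (|v|^2 |w|^2 + 2 <v,w>^2) / (n (n + 2))].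
    Indeed [E <v,Ux>^(2k)] is invariant under rotations of [v] and homogeneous,
    hence is [c |v|^(2k)]; for [k = 2] polarization gives the mixed moments up to
    the factor [c], which is found by summing over an orthonormal basis.
    Summing over the rows of [T] yields
    [E_U |T U x|^4 = |x|^4 (t^2 + 2 g) / (n (n + 2))].

    Averaging over [X] uses [E |X|^2 = n] and
    [E |X|^4 <= n^2 + C1 n], which is the variance hypothesis since
    [lambda_X = 1].  The averaged variance is thus at most
    [(t^2 + 2 g) (n + C1) / (n + 2) - t^2], and [g <= L t], [t <= n L] and
    [C1 >= 1] bound it by [3 C1 L t] ([mean_deviation_le]). *)

(** * The Euclidean inner product and the orthogonal group *)

Section inner_product.
Variables (R : realType) (n : nat).
Implicit Types (x y z v w : 'cV[R]_n) (A U : 'M[R]_n).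

Lemma dotcvE x y : dotcv x y = (x^T *m y) 0 0.
Proof. by rewrite mxE; apply: eq_bigr => i _; rewrite mxE. Qed.

Lemma dotcvC x y : dotcv x y = dotcv y x.
Proof. by apply: eq_bigr => i _; rewrite mulrC. Qed.

Lemma dotcvDr x y z : dotcv x (y + z) = dotcv x y + dotcv x z.
Proof. by rewrite !dotcvE mulmxDr mxE. Qed.

Lemma dotcvZr a x y : dotcv x (a *: y) = a * dotcv x y.
Proof. by rewrite !dotcvE -scalemxAr mxE. Qed.

Lemma dotcvBr x y z : dotcv x (y - z) = dotcv x y - dotcv x z.
Proof. by rewrite -scaleN1r dotcvDr dotcvZr mulN1r. Qed.

Lemma dotcvDl x y z : dotcv (x + y) z = dotcv x z + dotcv y z.
Proof. by rewrite !(dotcvC _ z) dotcvDr. Qed.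

Lemma dotcvZl a x y : dotcv (a *: x) y = a * dotcv x y.
Proof. by rewrite !(dotcvC _ y) dotcvZr. Qed.

Lemma dotcvBl x y z : dotcv (x - y) z = dotcv x z - dotcv y z.
Proof. by rewrite !(dotcvC _ z) dotcvBr. Qed.

Lemma dotcv0l x : dotcv 0 x = 0.
Proof. by rewrite -(scale0r 0) dotcvZl mul0r. Qed.

Lemma dotcv_adj A x y : dotcv (A *m x) y = dotcv x (A^T *m y).
Proof. by rewrite !dotcvE trmx_mul mulmxA. Qed.

Lemma dotcv_ge0 x : 0 <= dotcv x x.
Proof. by apply: sumr_ge0 => i _; rewrite -expr2 sqr_ge0. Qed.

Lemma dotcv_eq0 x : dotcv x x = 0 -> x = 0.
Proof.
move=> /eqP; rewrite psumr_eq0; last by move=> i _; rewrite -expr2 sqr_ge0.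
move=> /allP x0; apply/matrixP => i j; rewrite ord1 mxE.
by have := x0 i (mem_index_enum i); rewrite mulf_eq0 orbb => /eqP.
Qed.

Lemma dotcv_basis x (i : 'I_n) : dotcv x (basis_cV i) = x i 0.
Proof.
rewrite /dotcv (bigD1 i)//= mxE !eqxx mulr1 big1 ?addr0// => j ji.
by rewrite mxE (negbTE ji) mulr0.
Qed.

Lemma dotcv_basis2 (i j : 'I_n) :
  dotcv (basis_cV i) (basis_cV j : 'cV[R]_n) = (i == j)%:R.
Proof. by rewrite dotcv_basis mxE andbT eq_sym. Qed.

Lemma dotcv_parseval x : dotcv x x = \sum_i dotcv x (basis_cV i) ^+ 2.
Proof. by apply: eq_bigr => i _; rewrite dotcv_basis expr2. Qed.

Lemma enorm_sqr x : enorm x ^+ 2 = dotcv x x.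
Proof. by rewrite sqr_sqrtr// dotcv_ge0. Qed.

Lemma unit_sphereP x : unit_sphere n x <-> dotcv x x = 1.
Proof.
split=> [x1|x1]; first by rewrite -enorm_sqr (x1 : enorm x = 1) expr1n.
by rewrite /unit_sphere /= /enorm x1 sqrtr1.
Qed.

Lemma dotcv_CS x y : dotcv x y ^+ 2 <= dotcv x x * dotcv y y.
Proof.
have [x0|x0] := eqVneq (dotcv x x) 0.
  by rewrite (dotcv_eq0 x0) !dotcv0l mul0r expr0n.
have xp : 0 < dotcv x x by rewrite lt_def x0 dotcv_ge0.
have := dotcv_ge0 (dotcv x x *: y - dotcv x y *: x).
rewrite !(dotcvBl, dotcvBr, dotcvZl, dotcvZr) (dotcvC y x) => h.
rewrite -subr_ge0 -(pmulr_rge0 _ xp).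
by move: h; congr (is_true (0 <= _)); ring.
Qed.

Lemma orthogonal_dotcv U x y :
  orthogonal_group n U -> dotcv (U *m x) (U *m y) = dotcv x y.
Proof. by move=> oU; rewrite dotcv_adj mulmxA oU mul1mx. Qed.

Lemma orthogonal_tr U : orthogonal_group n U -> orthogonal_group n U^T.
Proof. by rewrite /orthogonal_group /= trmxK => /mulmx1C. Qed.

Lemma orthogonal_mul U V :
  orthogonal_group n U -> orthogonal_group n V -> orthogonal_group n (U *m V).
Proof.
move=> oU oV; rewrite /orthogonal_group /= trmx_mul mulmxA -(mulmxA V^T).
by rewrite (oU : U^T *m U = _) mulmx1.
Qed.

(** The witness is the reflection in the hyperplane orthogonal to [v - w]. *)
Lemma orthogonal_transitive v w : dotcv v v = dotcv w w ->
  exists2 H, orthogonal_group n H & H *m v = w.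
Proof.
move=> vw; have [->|] := eqVneq v w.
  by exists 1%:M; rewrite ?mul1mx// /orthogonal_group /= trmx1 mulmx1.
rewrite -subr_eq0 => u_neq0; set u := v - w in u_neq0.
have uu : dotcv u u != 0 by apply: contra_neq u_neq0 => /dotcv_eq0.
have uuE : dotcv u u = 2 * dotcv u v.
  by rewrite /u !(dotcvBl, dotcvBr) (dotcvC w v) vw; ring.
pose a := 2 / dotcv u u.
have uuM : u^T *m u = (dotcv u u)%:M.
  by apply/matrixP => i j; rewrite !ord1 -dotcvE mxE eqxx mulr1n.
exists (1%:M - a *: (u *m u^T)); rewrite /orthogonal_group /=.
  have -> : (1%:M - a *: (u *m u^T))^T = 1%:M - a *: (u *m u^T).
    apply/matrixP => i j; rewrite !mxE (eq_sym j i).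
    by congr (_ - a * _); apply: eq_bigr => k _; rewrite !mxE mulrC.
  rewrite mulmxBl mul1mx mulmxBr mulmx1 -scalemxAr -scalemxAl scalerA.
  rewrite mulmxA -(mulmxA u) uuM mul_mx_scalar -scalemxAl scalerA.
  rewrite (_ : a * a * dotcv u u = a + a); last by rewrite /a; field.
  by rewrite scalerDl opprB addrK subrK.
rewrite mulmxBl mul1mx -scalemxAl -mulmxA.
rewrite (_ : u^T *m v = (dotcv u v)%:M); last first.
  by apply/matrixP => i j; rewrite !ord1 -dotcvE mxE eqxx mulr1n.
rewrite mul_mx_scalar scalerA (_ : a * dotcv u v = 1).
  by rewrite scale1r /u opprB addrC subrK.
by rewrite /a -mulrA [X in _ * X]mulrC mulrA -uuE divff.
Qed.

End inner_product.
(** * Hilbert-Schmidt norms as sums over the rows *)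

Section frames.
Variables (R : realType) (n : nat).
Implicit Types (x v w : 'cV[R]_n) (A T : 'M[R]_n).

Definition matrix_row T (k : 'I_n) : 'cV[R]_n := T^T *m basis_cV k.

Definition frobenius2 T : R :=
  \sum_k dotcv (matrix_row T k) (matrix_row T k).

(** The squared Hilbert-Schmidt norm of [T T^T]. *)
Definition gram2 T : R :=
  \sum_k \sum_l dotcv (matrix_row T k) (matrix_row T l) ^+ 2.

Lemma dotcv_mulmx T x :
  dotcv (T *m x) (T *m x) = \sum_k dotcv (matrix_row T k) x ^+ 2.
Proof.
rewrite dotcv_parseval; apply: eq_bigr => k _.
by rewrite dotcv_adj (dotcvC x).
Qed.

Lemma frobenius2_ge0 T : 0 <= frobenius2 T.
Proof. by apply: sumr_ge0 => k _; exact: dotcv_ge0. Qed.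

Lemma frobenius2_gt0 T : (0 < n)%N -> T \in unitmx -> 0 < frobenius2 T.
Proof.
move=> n0 uT; rewrite lt_def frobenius2_ge0 andbT; apply/eqP => /eqP.
rewrite psumr_eq0 => [/allP h|k _]; last exact: dotcv_ge0.
pose i := Ordinal n0.
have /eqP/dotcv_eq0 ti := h i (mem_index_enum i).
have e0 : basis_cV i = 0 :> 'cV[R]_n.
  rewrite -(mulKmx (_ : T^T \in unitmx) (basis_cV i)) ?unitmx_tr//.
  by rewrite [X in _ *m X]ti mulmx0.
have := dotcv_basis2 R i i; rewrite e0 dotcv0l eqxx.
by move/eqP; rewrite eq_sym oner_eq0.
Qed.

(** Both operators have the same norm: [|T x|^2 = <x, T^T T x>], and
    Cauchy-Schwarz bounds the right-hand side by [|x| sqrt L |T x|]. *)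
Lemma adjoint_bound T (L : R) : 0 <= L ->
  (forall x, dotcv (T^T *m x) (T^T *m x) <= L * dotcv x x) ->
  forall x, dotcv (T *m x) (T *m x) <= L * dotcv x x.
Proof.
move=> L0 hL x; set q := dotcv (T *m x) (T *m x).
have q0 : 0 <= q := dotcv_ge0 _.
have [->|qN0] := eqVneq q 0; first by rewrite mulr_ge0 ?dotcv_ge0.
have qp : 0 < q by rewrite lt_def qN0.
rewrite -(ler_pM2r qp) -expr2 {1}/q dotcv_adj.
apply: le_trans (dotcv_CS _ _) _; rewrite mulrAC mulrC [leRHS]mulrC.
by rewrite (mulrC (dotcv x x)) ler_wpM2r ?dotcv_ge0 ?hL.
Qed.

(** [gram2 T] is the sum of [|T r|^2] over the rows [r] of [T]. *)
Lemma gram2_le T (L : R) : 0 <= L ->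
  (forall x, dotcv (T^T *m x) (T^T *m x) <= L * dotcv x x) ->
  gram2 T <= L * frobenius2 T.
Proof.
move=> L0 hL; rewrite mulr_sumr; apply: ler_sum => k _.
under eq_bigr do rewrite dotcvC.
by rewrite -dotcv_mulmx; exact: adjoint_bound.
Qed.

Lemma frobenius2_le T (L : R) :
  (forall x, dotcv (T^T *m x) (T^T *m x) <= L * dotcv x x) ->
  frobenius2 T <= n%:R * L.
Proof.
move=> hL; have -> : n%:R * L = \sum_(k < n) L.
  by rewrite sumr_const card_ord mulr_natl.
apply: ler_sum => k _; apply: le_trans (hL _) _.
by rewrite dotcv_basis2 eqxx mulr1.
Qed.

End frames.

(** * Integrable functions with a known real integral *)

Section has_integral.
Context d (T : measurableType d) (R : realType).
Variables (mu : {measure set T -> \bar R}) (D : set T).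
Hypothesis mD : measurable D.
Implicit Types (f g : T -> R) (r s : R).

(** Equations between means become equations between reals once
    integrability and value are carried together. *)
Definition has_integral f r :=
  mu.-integrable D (EFin \o f) /\ (\int[mu]_(x in D) (f x)%:E = r%:E)%E.

Lemma has_integral_uniq f r s : has_integral f r -> has_integral f s -> r = s.
Proof. by move=> [_ fr] [_]; rewrite fr => -[]. Qed.

Lemma has_integral_ext f g r :
  (forall x, D x -> f x = g x) -> has_integral f r -> has_integral g r.
Proof.
move=> fg [fi fr]; have fg' : {in D, EFin \o f =1 EFin \o g}.
  by move=> x /set_mem Dx /=; rewrite fg.
split; first exact: eq_integrable fi.
by rewrite -fr; apply: eq_integral => x xD; rewrite fg//; exact: set_mem.
Qed.

Lemma has_integralD f g r s : has_integral f r -> has_integral g s ->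
  has_integral (fun x => f x + g x) (r + s).
Proof.
move=> [fi fr] [gi gs]; split; first exact: (integrableD mD fi gi).
by rewrite (integralD_EFin mD fi gi) fr gs.
Qed.

Lemma has_integralZ c f r : has_integral f r ->
  has_integral (fun x => c * f x) (c * r).
Proof.
move=> [fi fr]; split; first exact: (integrableZl mD c fi).
by under eq_integral do rewrite EFinM; rewrite (integralZl mD fi) fr.
Qed.

Lemma has_integral_cst c : mu D = 1%E -> has_integral (fun=> c) c.
Proof.
move=> D1; split.
  apply: (measurable_bounded_integrable mD); rewrite ?D1 ?ltry//.
  by exists `|c|; split; rewrite ?num_real// => M cM x _ /=; exact: ltW.
by rewrite integral_cst// D1 mule1.
Qed.

Lemma has_integral_sum (I : Type) (s : seq I) (F : I -> T -> R) (r : I -> R) :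
  (forall i, has_integral (F i) (r i)) ->
  has_integral (fun x => \sum_(i <- s) F i x) (\sum_(i <- s) r i).
Proof.
move=> Fr; elim: s => [|i s IH].
  rewrite big_nil; apply: (@has_integral_ext (fun=> 0)) => [x _|].
    by rewrite big_nil.
  split; first exact: integrable0.
  by rewrite integral0.
rewrite big_cons; apply: has_integral_ext (has_integralD (Fr i) IH) => x _.
by rewrite big_cons.
Qed.

Lemma has_integral_bounded f M : (mu D < +oo)%E -> measurable_fun D f ->
  (forall x, D x -> `|f x| <= M) -> exists r, has_integral f r.
Proof.
move=> D1 mf fM; exists (fine (\int[mu]_(x in D) (f x)%:E)).
have fi : mu.-integrable D (EFin \o f).
  apply: measurable_bounded_integrable => //.
  by exists M; split; rewrite ?num_real// => N MN x Dx /=;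
    exact: le_trans (fM x Dx) (ltW MN).
by split=> //; rewrite fineK// integrable_fin_num.
Qed.

Lemma has_integral_ge0 f r : measurable_fun D f -> (forall x, 0 <= f x) ->
  (\int[mu]_(x in D) (f x)%:E = r%:E)%E -> has_integral f r.
Proof.
move=> mf f0 fr; split=> //; apply/integrableP; split.
  exact/measurable_EFinP.
under eq_integral do rewrite /= ger0_norm//.
by rewrite fr ltry.
Qed.

End has_integral.
(** * Measurability of vector expressions *)

Section measurability.
Context d (T : measurableType d) (R : realType).

Lemma measurable_fun_entry (m n : nat) (F : T -> 'M[R]_(m, n)) i j :
  measurable_fun setT F -> measurable_fun setT (fun t => F t i j).
Proof.
by move=> mF; exact: (measurableT_comp (@measurable_entry R m n i j) mF).
Qed.

Lemma measurable_mulmx (m n p : nat) (F : T -> 'M[R]_(m, n))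
    (G : T -> 'M[R]_(n, p)) : measurable_fun setT F -> measurable_fun setT G ->
  measurable_fun setT (fun t => F t *m G t).
Proof.
move=> mF mG; apply: measurable_fun_matrixP => i j.
under eq_fun do rewrite mxE.
apply: measurable_sum => k.
by apply: measurable_funM; exact: measurable_fun_entry.
Qed.

Lemma measurable_dotcv (n : nat) (F G : T -> 'cV[R]_n) :
  measurable_fun setT F -> measurable_fun setT G ->
  measurable_fun setT (fun t => dotcv (F t) (G t)).
Proof.
move=> mF mG; apply: measurable_sum => k.
by apply: measurable_funM; exact: measurable_fun_entry.
Qed.

End measurability.

(** The group is the zero set of the squared distance from [U^T U] to the
    identity, a single measurable real function. *)
Lemma measurable_orthogonal_group (R : realType) (n : nat) :
  measurable (@orthogonal_group R n).
Proof.
pose f (U : 'M[R]_n) := \sum_i \sum_j ((U^T *m U - 1%:M) i j) ^+ 2.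
have -> : orthogonal_group n = setT `&` f @^-1` [set 0].
  rewrite setTI; apply/seteqP; split => U /=.
    move=> oU; rewrite /f big1// => i _; rewrite big1// => j _.
    by rewrite (oU : _ = _) subrr mxE expr0n.
  move=> /eqP; rewrite psumr_eq0 => [/allP h|i _]; last first.
    by apply: sumr_ge0 => j _; exact: sqr_ge0.
  rewrite /orthogonal_group /=; apply/subr0_eq/matrixP => i j; rewrite [RHS]mxE.
  have := h i (mem_index_enum i).
  rewrite /= psumr_eq0 => [/allP hi|k _]; last exact: sqr_ge0.
  by have := hi j (mem_index_enum j); rewrite /= sqrf_eq0 => /eqP.
suff mf : measurable_fun setT f by exact: mf.
apply: measurable_sum => i; apply: measurable_sum => j.
apply: measurable_funX; under eq_fun do rewrite mxE.
apply: measurable_funD => //; under eq_fun do rewrite mxE.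
apply: measurable_sum => k; apply: measurable_funM; last exact: measurable_entry.
by under eq_fun do rewrite mxE; exact: measurable_entry.
Qed.

(** * Moments of a Haar-rotated vector *)

Section haar_moments.
Variables (R : realType) (n : nat) (mu : probability 'M[R]_n R).
Hypothesis n_gt0 : (0 < n)%N.
Hypothesis mu_haar : is_haar_orthogonal mu.
Implicit Types (x v w : 'cV[R]_n) (T U V : 'M[R]_n).

Local Notation O := (@orthogonal_group R n).
Local Notation mO := (@measurable_orthogonal_group R n).
Local Notation haar_mean := (has_integral mu O).

Lemma haar_invariant (f : 'M[R]_n -> R) r V : O V ->
  measurable_fun setT f -> (forall U, 0 <= f U) ->
  haar_mean f r -> haar_mean (fun U => f (V *m U)) r.
Proof.
move=> oV mf f0 [_ fr].
have mV : measurable_fun setT (fun U : 'M[R]_n => V *m U).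
  exact: measurable_mulmx.
have preO : (fun U : 'M[R]_n => V *m U) @^-1` O = O.
  apply/seteqP; split => U /= oU; last exact: orthogonal_mul.
  rewrite -(mul1mx U) -(oV : _ = _) -mulmxA.
  by apply: orthogonal_mul => //; exact: orthogonal_tr.
apply: has_integral_ge0 => //.
  by apply: measurable_funTS; exact: measurableT_comp mf mV.
(* The push-forward of [mu] by [U |-> V U] is [mu]: the preimage of [A] is its
   translate by [V^T]. *)
rewrite -fr -[in LHS]preO.
rewrite -(ge0_integral_pushforward mV mu (f := EFin \o f) mO); first last.
- by move=> U _; rewrite /= lee_fin.
- exact/measurable_EFinP/measurable_funTS.
apply: eq_measure_integral => A mA _; rewrite /pushforward.
have [_ inv] := mu_haar; rewrite [RHS](esym (inv V^T A (orthogonal_tr oV) mA)).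
congr (mu _); apply/seteqP; split => [U AU|_ [U AU <-]] /=.
  by exists (V *m U) => //; rewrite mulmxA (oV : _ = _) mul1mx.
by rewrite mulmxA (mulmx1C oV) mul1mx.
Qed.

Lemma measurable_haar_form x v :
  measurable_fun setT (fun U : 'M[R]_n => dotcv v (U *m x)).
Proof. by apply: measurable_dotcv => //; exact: measurable_mulmx. Qed.

(** If [H] is orthogonal and maps [|v| e] to [v], for a fixed unit vector [e],
    then [<v,Ux> = |v| <e,H^T U x>], and [H^T U] has the law of [U]; so [c] is the
    moment for [e].  Even powers are nonnegative, as [haar_invariant] requires. *)
Lemma haar_even_moment x (k : nat) : exists c, forall v,
  haar_mean (fun U => dotcv v (U *m x) ^+ (2 * k)) (c * dotcv v v ^+ k).
Proof.
pose e : 'cV[R]_n := basis_cV (Ordinal n_gt0).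
have ee : dotcv e e = 1 by rewrite dotcv_basis2 eqxx.
pose f (U : 'M[R]_n) := dotcv e (U *m x) ^+ (2 * k).
have mf : measurable_fun setT f.
  by apply: measurable_funX; exact: measurable_haar_form.
have f0 U : 0 <= f U by rewrite /f exprM exprn_ge0// sqr_ge0.
have [c fc] : exists c, haar_mean f c.
  apply: (has_integral_bounded (M := dotcv x x ^+ k) mO).
  - exact: le_lt_trans (probability_le1 mu mO) (ltry 1).
  - exact: measurable_funTS.
  - move=> U oU; rewrite ger0_norm// /f exprM lerXn2r ?nnegrE ?sqr_ge0//.
      exact: dotcv_ge0.
    by have := dotcv_CS e (U *m x); rewrite ee mul1r orthogonal_dotcv.
exists c => v; pose N := Num.sqrt (dotcv v v).
have NN : N ^+ 2 = dotcv v v by rewrite sqr_sqrtr// dotcv_ge0.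
have [|H oH Hv] := @orthogonal_transitive _ _ (N *: e) v.
  by rewrite dotcvZl dotcvZr ee mulr1 -expr2.
have h := has_integralZ mO (dotcv v v ^+ k)
  (haar_invariant (orthogonal_tr oH) mf f0 fc).
rewrite mulrC; apply: (has_integral_ext mO) h => U _.
rewrite /f -NN -Hv dotcv_adj dotcvZl mulmxA -exprM.
by rewrite [RHS]exprMn.
Qed.

Lemma haar_moment2 x v :
  haar_mean (fun U => dotcv v (U *m x) ^+ 2)
    (dotcv x x / n%:R * dotcv v v).
Proof.
have [c hc] := haar_even_moment x 1.
have nN0 : n%:R != 0 :> R by rewrite pnatr_eq0 -lt0n.
suff <- : c = dotcv x x / n%:R by exact: (hc v).
(* The squared coordinates of [U x] have the common mean [c] and sum to the
   constant [|x|^2]. *)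
have h1 := has_integral_sum mO (index_enum 'I_n) (fun i => hc (basis_cV i)).
have h2 := has_integral_cst mO (dotcv x x) (proj1 mu_haar).
have h3 : haar_mean (fun=> dotcv x x)
    (\sum_i c * dotcv (basis_cV i) (basis_cV i : 'cV[R]_n) ^+ 1).
  apply: (has_integral_ext mO) h1 => U oU; rewrite -(orthogonal_dotcv x x oU).
  rewrite dotcv_parseval; apply: eq_bigr => i _.
  by rewrite muln1 dotcvC.
have := has_integral_uniq h2 h3.
under eq_bigr do rewrite dotcv_basis2 eqxx expr1 mulr1.
rewrite sumr_const card_ord => ->.
by rewrite -[X in X / _]mulr_natr mulfK.
Qed.

(** Polarization: [12 a^2 b^2 = (a+b)^4 + (a-b)^4 - 2 a^4 - 2 b^4]. *)
Lemma haar_moment22 x v w :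
  haar_mean (fun U => dotcv v (U *m x) ^+ 2 * dotcv w (U *m x) ^+ 2)
    (dotcv x x ^+ 2 / (n%:R * (n%:R + 2)) *
     (dotcv v v * dotcv w w + 2 * dotcv v w ^+ 2)).
Proof.
have [c hc] := haar_even_moment x 2.
have nN0 : n%:R != 0 :> R by rewrite pnatr_eq0 -lt0n.
have n2N0 : n%:R + 2 != 0 :> R by rewrite -natrD pnatr_eq0 addn2.
have pol a b : haar_mean
    (fun U => dotcv a (U *m x) ^+ 2 * dotcv b (U *m x) ^+ 2)
    (c / 3 * (dotcv a a * dotcv b b + 2 * dotcv a b ^+ 2)).
  have := has_integralZ mO 12^-1 (has_integralD mO
    (has_integralD mO (hc (a + b)) (hc (a - b)))
    (has_integralZ mO (- 2) (has_integralD mO (hc a) (hc b)))).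
  rewrite !(dotcvBl, dotcvBr, dotcvDl, dotcvDr) (dotcvC b a).
  rewrite (_ : 12^-1 * _ = c / 3 * (dotcv a a * dotcv b b + 2 * dotcv a b ^+ 2)).
    apply: (has_integral_ext mO) => U _; rewrite !dotcvBl !dotcvDl.
    by field.
  by field.
suff <- : c / 3 = dotcv x x ^+ 2 / (n%:R * (n%:R + 2)) by exact: pol.
(* Over all pairs of basis vectors the mixed moments add up to [|x|^4], and the
   right-hand sides to [c / 3 * n (n + 2)]. *)
have h1 := has_integral_sum mO (index_enum 'I_n) (fun i =>
  has_integral_sum mO (index_enum 'I_n)
    (fun j => pol (basis_cV i) (basis_cV j))).
have h2 := has_integral_cst mO (dotcv x x ^+ 2) (proj1 mu_haar).
have h3 := has_integral_uniq h2 (has_integral_ext mO _ h1).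
rewrite h3 => [|U oU]; last first.
  rewrite -(orthogonal_dotcv x x oU) dotcv_parseval expr2 mulr_suml.
  apply: eq_bigr => i _; rewrite mulr_sumr; apply: eq_bigr => j _.
  by rewrite !(dotcvC (basis_cV _)).
under eq_bigr => i _.
  rewrite -mulr_sumr big_split /=.
  under eq_bigr do rewrite !dotcv_basis2 !eqxx mulr1.
  rewrite sumr_const card_ord -mulr_sumr (bigD1 i)//= dotcv_basis2 eqxx.
  rewrite big1 ?addr0; last first.
    by move=> j ji; rewrite dotcv_basis2 eq_sym (negbTE ji) expr0n.
  over.
rewrite sumr_const card_ord -[X in _ = X / _]mulr_natr /=.
by field; rewrite nN0 n2N0.
Qed.

Lemma haar_frame2 T x :
  haar_mean (fun U => dotcv (T *m (U *m x)) (T *m (U *m x)))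
    (dotcv x x / n%:R * frobenius2 T).
Proof.
rewrite mulr_sumr; apply: (has_integral_ext mO) (has_integral_sum mO _
  (fun k => haar_moment2 x (matrix_row T k))) => U _.
by rewrite dotcv_mulmx.
Qed.

Lemma haar_frame4 T x :
  haar_mean (fun U => dotcv (T *m (U *m x)) (T *m (U *m x)) ^+ 2)
    (dotcv x x ^+ 2 / (n%:R * (n%:R + 2)) *
     (frobenius2 T ^+ 2 + 2 * gram2 T)).
Proof.
have -> : frobenius2 T ^+ 2 + 2 * gram2 T = \sum_k \sum_l
    (dotcv (matrix_row T k) (matrix_row T k) *
     dotcv (matrix_row T l) (matrix_row T l) +
     2 * dotcv (matrix_row T k) (matrix_row T l) ^+ 2).
  rewrite expr2 mulr_suml mulr_sumr -big_split; apply: eq_bigr => k _ /=.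
  by rewrite !mulr_sumr -big_split.
rewrite mulr_sumr; under [X in haar_mean _ X]eq_bigr do rewrite mulr_sumr.
apply: (has_integral_ext mO) (has_integral_sum mO _ (fun k => has_integral_sum mO _
  (fun l => haar_moment22 x (matrix_row T k) (matrix_row T l)))) => U _.
rewrite dotcv_mulmx expr2 mulr_suml; apply: eq_bigr => k _.
by rewrite mulr_sumr.
Qed.

End haar_moments.
(** * The squared operator norm *)

Section operator_norm.
Variables (R : realType) (n : nat).
Implicit Types (x : 'cV[R]_n) (A T U : 'M[R]_n).

(** Stated through the transpose because [lambda_sq] of [A X] tests [A X] against
    unit vectors, and [E <A X, xi>^2 = |A^T xi|^2] when [X] is isotropic. *)
Definition opnorm2 A : \bar R :=
  ereal_sup [set (dotcv (A^T *m xi) (A^T *m xi))%:E | xi in unit_sphere n].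

(** The supremum is finite because the operator norm is at most the
    Hilbert-Schmidt norm. *)
Lemma opnorm2_fin A : (0 < n)%N -> exists L, [/\ 0 <= L, opnorm2 A = L%:E &
  forall x, dotcv (A^T *m x) (A^T *m x) <= L * dotcv x x].
Proof.
move=> n0.
have bnd x : dotcv (A^T *m x) (A^T *m x) <= frobenius2 A * dotcv x x.
  apply: adjoint_bound (frobenius2_ge0 A) _ x => x.
  rewrite trmxK dotcv_mulmx mulr_suml; apply: ler_sum => k _.
  exact: dotcv_CS.
have lb xi : dotcv xi xi = 1 ->
    ((dotcv (A^T *m xi) (A^T *m xi))%:E <= opnorm2 A)%E.
  by move=> /unit_sphereP xi1; apply: ereal_sup_ubound; exists xi.
have ge0 : (0 <= opnorm2 A)%E.
  have e1 : dotcv (basis_cV (Ordinal n0)) (basis_cV (Ordinal n0)) = 1 :> R.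
    by rewrite dotcv_basis2 eqxx.
  by apply: le_trans (lb _ e1); rewrite lee_fin dotcv_ge0.
have ub : (opnorm2 A <= (frobenius2 A)%:E)%E.
  apply: ge_ereal_sup => _ [xi /unit_sphereP xi1 <-].
  by rewrite lee_fin; have := bnd xi; rewrite xi1 mulr1.
move E : (opnorm2 A) ub ge0 lb => [L| |] //; rewrite ?lee_fin => _ L0 lb.
exists L; split=> // x.
have [x0|x0] := eqVneq (dotcv x x) 0.
  by rewrite (dotcv_eq0 x0) mulmx0 !dotcv0l mulr0.
have xp : 0 < dotcv x x by rewrite lt_def x0 dotcv_ge0.
pose N := Num.sqrt (dotcv x x).
have NN : N ^+ 2 = dotcv x x by rewrite sqr_sqrtr// dotcv_ge0.
have := lb (N^-1 *: x); rewrite -!scalemxAr !dotcvZl !dotcvZr !mulrA -!expr2.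
rewrite exprVn NN mulVf// lee_fin => /(_ erefl).
by rewrite mulrC ler_pdivrMr.
Qed.

Lemma opnorm2_mulmx_orthogonal T U :
  orthogonal_group n U -> opnorm2 (T *m U) = opnorm2 T.
Proof.
move=> oU; congr ereal_sup; apply: eq_imagel => xi _.
by rewrite trmx_mul -mulmxA orthogonal_dotcv//; exact: orthogonal_tr.
Qed.

Lemma frobenius2_mulmx_orthogonal T U :
  orthogonal_group n U -> frobenius2 (T *m U) = frobenius2 T.
Proof.
move=> oU; apply: eq_bigr => k _.
rewrite /matrix_row trmx_mul -mulmxA orthogonal_dotcv//.
exact: orthogonal_tr.
Qed.

Lemma opnorm2_1 : (opnorm2 (1%:M : 'M[R]_n) <= 1)%E.
Proof.
apply: ge_ereal_sup => _ [xi /unit_sphereP xi1 <-].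
by rewrite trmx1 mul1mx xi1.
Qed.

Lemma frobenius2_1 : frobenius2 (1%:M : 'M[R]_n) = n%:R :> R.
Proof.
rewrite /frobenius2; under eq_bigr do
  rewrite /matrix_row trmx1 mul1mx dotcv_basis2 eqxx.
by rewrite sumr_const card_ord.
Qed.

End operator_norm.

(** * Linear images of an isotropic vector *)

Section isotropic_moments.
Context d (Omega : measurableType d) (R : realType).
Variables (P : probability Omega R) (n : nat) (X : Omega -> 'cV[R]_n).
Hypothesis mX : measurable_fun setT X.
Hypothesis isoX : isotropic P X.
Implicit Types (A : 'M[R]_n) (v : 'cV[R]_n).

Local Notation mean := (has_integral P setT).
Local Notation mT := (@measurableT _ Omega).

Lemma has_integral_expectation (f : Omega -> R) r :
  mean f r -> ('E_P[f] = r%:E)%E.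
Proof. by move=> [_]; rewrite unlock. Qed.

(** Isotropy gives the value of the integral; integrability of a mixed product
    comes from [|ab| <= a^2 + b^2]. *)
Lemma isotropic_entries (i j : 'I_n) :
  mean (fun w => X w i 0 * X w j 0) (i == j)%:R.
Proof.
have mXi k : measurable_fun setT (fun w => X w k 0).
  exact: measurable_fun_entry.
have XX k l : (\int[P]_w (X w k 0 * X w l 0)%:E = ((k == l)%:R)%:E)%E.
  have [_ /(_ k l) <-] := isoX; rewrite unlock; apply: eq_integral => w _.
  by rewrite !dotcv_basis.
have diag k : mean (fun w => X w k 0 ^+ 2) 1.
  apply: has_integral_ge0 => [|w|].
  - exact: measurable_funX.
  - exact: sqr_ge0.
  - by have := XX k k; rewrite eqxx.
split; last exact: XX.
apply: le_integrable (proj1 (has_integralD mT (diag i) (diag j))) => //.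
  by apply/measurable_EFinP; exact: measurable_funM.
move=> w _ /=; rewrite lee_fin ler_norml.
rewrite ger0_norm ?addr_ge0 ?sqr_ge0//; apply/andP; split; nra.
Qed.

Lemma isotropic_form v : mean (fun w => dotcv v (X w) ^+ 2) (dotcv v v).
Proof.
have h := has_integral_sum mT (index_enum 'I_n) (fun i =>
  has_integral_sum mT (index_enum 'I_n) (fun j =>
    has_integralZ mT (v i 0 * v j 0) (isotropic_entries i j))).
have -> : dotcv v v = \sum_i \sum_j v i 0 * v j 0 * (i == j)%:R.
  apply: eq_bigr => i _; rewrite (bigD1 i)//= eqxx mulr1 big1 ?addr0// => j ji.
  by rewrite eq_sym (negbTE ji) mulr0.
apply: (has_integral_ext mT) h => w _.
rewrite expr2 mulr_suml; apply: eq_bigr => i _.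
by rewrite mulr_sumr; apply: eq_bigr => j _; rewrite mulrACA.
Qed.

Lemma isotropic_norm2 A :
  mean (fun w => dotcv (A *m X w) (A *m X w)) (frobenius2 A).
Proof.
apply: (has_integral_ext mT) (has_integral_sum mT _
  (fun k => isotropic_form (matrix_row A k))) => w _.
by rewrite dotcv_mulmx.
Qed.

Lemma isotropic_lambda_sq A : lambda_sq P (fun w => A *m X w) = opnorm2 A.
Proof.
congr ereal_sup; apply: eq_imagel => xi _.
rewrite -(has_integral_expectation (isotropic_form (A^T *m xi))).
by congr expectation; apply/funext => w; rewrite dotcv_adj dotcvC.
Qed.

Lemma isotropic_variance A :
  ('V_P[(fun w => enorm (A *m X w) ^+ 2)%R] =
   \int[P]_w ((dotcv (A *m X w) (A *m X w) - frobenius2 A) ^+ 2)%R%:E)%E.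
Proof.
rewrite /variance unlock; under eq_fun do rewrite enorm_sqr.
rewrite (has_integral_expectation (isotropic_norm2 A)) unlock.
by apply: eq_integral => w _.
Qed.

(** A linear image of [X] has [E |A X|^2 = frobenius2 A] and
    [lambda_{AX}^2 = opnorm2 A], so only the variance is left as an integral. *)
Lemma isotropic_variance_conjecture A C :
  variance_conjecture P (fun w => A *m X w) C <->
  (\int[P]_w ((dotcv (A *m X w) (A *m X w) - frobenius2 A) ^+ 2)%R%:E
   <= C%:E * opnorm2 A * (frobenius2 A)%:E)%E.
Proof.
rewrite /variance_conjecture isotropic_variance isotropic_lambda_sq.
rewrite [X in expectation _ X](_ : _ = fun w => dotcv (A *m X w) (A *m X w)).
  by rewrite (has_integral_expectation (isotropic_norm2 A)).
by apply/funext => w; rewrite enorm_sqr.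
Qed.

End isotropic_moments.
(** * The variance averaged over the orthogonal group *)

Section haar_average.
Variables (R : realType) (n : nat) (mu : probability 'M[R]_n R).
Hypothesis n_gt0 : (0 < n)%N.
Hypothesis mu_haar : is_haar_orthogonal mu.

Local Notation O := (@orthogonal_group R n).
Local Notation mO := (@measurable_orthogonal_group R n).

(** Haar means are taken over [O(n)], where the integrands are bounded, while
    Tonelli's theorem exchanges integrals over whole spaces. *)
Lemma haar_integral_setT (F : 'M[R]_n -> \bar R) :
  measurable_fun setT F -> (forall U, (0 <= F U)%E) ->
  (\int[mu]_(U in O) F U = \int[mu]_U F U)%E.
Proof.
move=> mF F0.
rewrite [RHS](ge0_negligible_integral (N := ~` O))//; first last.
- by apply: (etrans (probability_setC mu mO)); rewrite (proj1 mu_haar) subee.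
- by apply: measurableC; exact: mO.
by rewrite setDE setTI setCK.
Qed.

(** The Haar mean of [(|T U x|^2 - frobenius2 T)^2], by expanding the square and
    inserting the moments of [|T U x|^2]. *)
Definition mean_square_deviation (T : 'M[R]_n) (x : 'cV[R]_n) : R :=
  dotcv x x ^+ 2 / (n%:R * (n%:R + 2)) * (frobenius2 T ^+ 2 + 2 * gram2 T)
  - 2 * frobenius2 T ^+ 2 / n%:R * dotcv x x + frobenius2 T ^+ 2.

Lemma haar_square_deviation T x :
  has_integral mu O
    (fun U => (dotcv (T *m (U *m x)) (T *m (U *m x)) - frobenius2 T) ^+ 2)
    (mean_square_deviation T x).
Proof.
have nN0 : n%:R != 0 :> R by rewrite pnatr_eq0 -lt0n.
have n2N0 : n%:R + 2 != 0 :> R by rewrite -natrD pnatr_eq0 addn2.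
have h := has_integralD mO (has_integralD mO (haar_frame4 n_gt0 mu_haar T x)
  (has_integralZ mO (- 2 * frobenius2 T) (haar_frame2 n_gt0 mu_haar T x)))
  (has_integral_cst mO (frobenius2 T ^+ 2) (proj1 mu_haar)).
rewrite (_ : mean_square_deviation T x =
  dotcv x x ^+ 2 / (n%:R * (n%:R + 2)) * (frobenius2 T ^+ 2 + 2 * gram2 T) +
  - 2 * frobenius2 T * (dotcv x x / n%:R * frobenius2 T) + frobenius2 T ^+ 2).
  by apply: (has_integral_ext mO) h => U _; ring.
by rewrite /mean_square_deviation; field; rewrite nN0.
Qed.

Context d (Omega : measurableType d) (P : probability Omega R).
Variable X : Omega -> 'cV[R]_n.
Hypothesis mX : measurable_fun setT X.

Definition square_deviation (T : 'M[R]_n) (p : 'M[R]_n * Omega) : R :=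
  (dotcv (T *m (p.1 *m X p.2)) (T *m (p.1 *m X p.2)) - frobenius2 T) ^+ 2.

Lemma measurable_square_deviation T : measurable_fun setT (square_deviation T).
Proof.
have mTUX : measurable_fun setT
    (fun p : 'M[R]_n * Omega => T *m (p.1 *m X p.2)).
  apply: measurable_mulmx => //; apply: measurable_mulmx => //.
  exact: measurableT_comp.
by apply: measurable_funX; apply: measurable_funB => //; exact: measurable_dotcv.
Qed.

Lemma measurable_mean_deviation T : measurable_fun setT
  (fun U : 'M[R]_n => (\int[P]_w (square_deviation T (U, w))%:E)%E).
Proof.
apply: (measurable_fun_fubini_tonelli_F (EFin \o square_deviation T)).
  by apply/measurable_EFinP; exact: measurable_square_deviation.
by move=> p; rewrite /= lee_fin sqr_ge0.
Qed.

Lemma haar_mean_deviation T :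
  (\int[mu]_(U in O) \int[P]_w (square_deviation T (U, w))%:E =
   \int[P]_w (mean_square_deviation T (X w))%:E)%E.
Proof.
have m2 : measurable_fun setT (EFin \o square_deviation T).
  by apply/measurable_EFinP; exact: measurable_square_deviation.
have p0 p : (0 <= (EFin \o square_deviation T) p)%E.
  by rewrite /= lee_fin sqr_ge0.
rewrite haar_integral_setT; last first.
- by move=> U; apply: integral_ge0 => w _; exact: (p0 (U, w)).
- exact: measurable_mean_deviation.
rewrite (fubini_tonelli (m1 := mu) (m2 := P) _ m2 p0).
apply: eq_integral => w _.
have [_ <-] := haar_square_deviation T (X w).
rewrite [RHS]haar_integral_setT//; last first.
  by move=> U; exact: (p0 (U, w)).
exact: (measurableT_comp m2 (@measurable_pair2 _ _ _ _ w)).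
Qed.

End haar_average.

(** The averaged variance in terms of [N = n], [s = Var |X|^2], the squared
    Hilbert-Schmidt norms [t] of [T] and [g] of [T T^T], and the squared operator
    norm [L]: the left side is at most
    [2 g (C1 + N) / (N + 2) + t^2 (C1 - 2) / (N + 2)], where the first term is
    bounded by [2 C1 L t] and the second by [C1 t^2 / N <= C1 L t]. *)
Lemma mean_deviation_le (R : realType) (N C1 L s t g : R) :
  1 <= N -> 1 <= C1 -> 0 <= L -> 0 <= t -> s <= C1 * N ->
  g <= L * t -> 0 <= g -> t <= N * L ->
  (t ^+ 2 + 2 * g) / (N * (N + 2)) * (s + N ^+ 2) - t ^+ 2 <= 3 * (C1 * L * t).
Proof.
move=> N1 C11 L0 t0 sC gL g0 tN.
have N0 : 0 < N by lra.
have D0 : 0 < N * (N + 2) by nra.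
have b0 : 0 <= (t ^+ 2 + 2 * g) / (N * (N + 2)).
  by rewrite divr_ge0 ?(ltW D0)//; nra.
have h1 : (t ^+ 2 + 2 * g) / (N * (N + 2)) * (s + N ^+ 2) <=
    (t ^+ 2 + 2 * g) / (N * (N + 2)) * (N * (C1 + N)).
  by rewrite ler_wpM2l//; nra.
rewrite lerBlDr; apply: le_trans h1 _.
rewrite (_ : _ * (N * (C1 + N)) = (t ^+ 2 + 2 * g) * (C1 + N) / (N + 2));
  last first.
  by field; rewrite !gt_eqF//; lra.
rewrite ler_pdivrMr; last by lra.
have h2 : g * (C1 + N) <= L * t * (C1 * (N + 2)).
  apply: ler_pM => //; nra.
have h3 : t ^+ 2 * C1 <= t * (N * L) * C1.
  by rewrite expr2 ler_wpM2r ?ler_wpM2l//; lra.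
have h4 : 0 <= C1 * L * t by rewrite !mulr_ge0//; lra.
have h5 : 0 <= t ^+ 2 by exact: sqr_ge0.
nra.
Qed.

Section isotropic_mean_deviation.
Context d (Omega : measurableType d) (R : realType).
Variables (P : probability Omega R) (n : nat) (X : Omega -> 'cV[R]_n) (C1 : R).
Hypothesis n_gt0 : (0 < n)%N.
Hypothesis mX : measurable_fun setT X.
Hypothesis isoX : isotropic P X.
Hypothesis C1_ge1 : 1 <= C1.
Hypothesis varX : variance_conjecture P X C1.

(** The hypothesis on [X] is the case of the identity operator, for which
    [opnorm2] is at most [1] and [frobenius2] is [n]; its finite right-hand side
    also makes the fourth moment of [|X|] finite. *)
Lemma isotropic_norm_variance : exists2 s, s <= C1 * n%:R &
  has_integral P setT (fun w => (dotcv (X w) (X w) - n%:R) ^+ 2) s.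
Proof.
have var1 : variance_conjecture P (fun w => 1%:M *m X w) C1.
  by under eq_fun do rewrite mul1mx.
have {var1} := (isotropic_variance_conjecture mX isoX 1%:M C1).1 var1.
under eq_integral do rewrite mul1mx frobenius2_1.
set I := (\int[P]_w _)%E => hI.
have I0 : (0 <= I)%E by apply: integral_ge0 => w _; rewrite lee_fin sqr_ge0.
have {}hI : (I <= (C1 * n%:R)%:E)%E.
  apply: le_trans hI _; rewrite frobenius2_1 EFinM.
  rewrite lee_wpmul2r ?lee_fin// -[leRHS]mule1.
  by rewrite lee_wpmul2l ?opnorm2_1// lee_fin (le_trans ler01 C1_ge1).
move E : I I0 hI => [s| |] // _ hs; exists s => //.
apply: has_integral_ge0 => //; last by move=> w; exact: sqr_ge0.
by apply: measurable_funX; apply: measurable_funB => //; exact: measurable_dotcv.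
Qed.

Lemma isotropic_mean_deviation (T : 'M[R]_n) (L : R) : 0 <= L ->
  (forall x, dotcv (T^T *m x) (T^T *m x) <= L * dotcv x x) ->
  (\int[P]_w (mean_square_deviation T (X w))%:E
   <= (3 * (C1 * L * frobenius2 T))%:E)%E.
Proof.
move=> L0 hL; have [s sC s_int] := isotropic_norm_variance.
have N1 : 1 <= n%:R :> R by rewrite ler1n.
have nN0 : n%:R != 0 :> R by rewrite pnatr_eq0 -lt0n.
have n2N0 : n%:R + 2 != 0 :> R by rewrite -natrD pnatr_eq0 addn2.
set t := frobenius2 T; set q := mean_square_deviation T.
pose b := (t ^+ 2 + 2 * gram2 T) / (n%:R * (n%:R + 2)).
have norm_int : has_integral P setT (fun w => dotcv (X w) (X w)) n%:R.
  rewrite -(frobenius2_1 R n).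
  apply: has_integral_ext (isotropic_norm2 mX isoX 1%:M) => // w _.
  by rewrite mul1mx.
have mT := @measurableT _ Omega.
have h := has_integralD mT (has_integralD mT (has_integralZ mT b s_int)
  (has_integralZ mT (2 * b * n%:R - 2 * t ^+ 2 / n%:R) norm_int))
  (has_integral_cst mT (t ^+ 2 - b * n%:R ^+ 2) (probability_setT P)).
have [_ ->] : has_integral P setT (fun w => q (X w))
    (b * s + (2 * b * n%:R - 2 * t ^+ 2 / n%:R) * n%:R +
     (t ^+ 2 - b * n%:R ^+ 2)).
  (* [q] is a quadratic polynomial in [|x|^2], expanded around its mean [n]. *)
  apply: (has_integral_ext mT) h => w _.
  rewrite /q /mean_square_deviation -/t /b.
  by field; rewrite nN0.
rewrite lee_fin.
have g0 : 0 <= gram2 T.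
  by apply: sumr_ge0 => k _; apply: sumr_ge0 => l _; exact: sqr_ge0.
have := mean_deviation_le N1 C1_ge1 L0 (frobenius2_ge0 T) sC (gram2_le L0 hL) g0
  (frobenius2_le hL).
rewrite -/t -/b; congr (is_true (_ <= _)).
by rewrite /b; field; rewrite nN0 n2N0.
Qed.

End isotropic_mean_deviation.

(** * Markov's inequality *)

Theorem corollary2p2 (R : realType) :
  exists C : R, 0 < C /\
  forall (n : nat) (d : measure_display) (Omega : measurableType d)
    (P : probability Omega R) (X : {RV P >-> 'cV[R]_n})
    (C1 : R) (T : 'M[R]_n) (mu : probability 'M[R]_n R),
    (0 < n)%N ->
    log_concave X ->
    isotropic P X ->
    1 <= C1 ->
    variance_conjecture P X C1 ->
    T \in unitmx ->
    is_haar_orthogonal mu ->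
    let good := [set U : 'M[R]_n | orthogonal_group n U /\
      variance_conjecture P (fun w => T *m (U *m X w)) (C * C1)] in
    measurable good /\ ((2^-1 : R)%:E < mu good)%E.
Proof.
(* The averaged variance is at most [3 C1 L t]; any constant above [6] makes
   Markov's bound smaller than one half. *)
exists 7; split=> [//|n d Omega P X C1 T mu n0 _ isoX C11 vX uT mu_haar good].
pose O := @orthogonal_group R n; pose mO := @measurable_orthogonal_group R n.
have mX : measurable_fun setT X by exact: measurable_funPT.
pose H U := (\int[P]_w (square_deviation X T (U, w))%:E)%E.
have mH : measurable_fun setT H := measurable_mean_deviation P mX T.
have H0 U : (0 <= H U)%E.
  by apply: integral_ge0 => w _; rewrite lee_fin sqr_ge0.
have [L [L0 EL hL]] := opnorm2_fin T n0.
set t := frobenius2 T; have t0 : 0 < t by exact: frobenius2_gt0.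
have N1 : 1 <= n%:R :> R by rewrite ler1n.
have Lpos : 0 < L.
  by have := frobenius2_le hL; rewrite -/t => tL; nra.
pose K := C1 * L * t.
have K0 : 0 < K by rewrite !mulr_gt0//; lra.
have goodP U : O U -> variance_conjecture P (fun w => T *m (U *m X w)) (7 * C1)
    <-> (H U <= (7 * K)%:E)%E.
  move=> oU; have -> : (fun w => T *m (U *m X w)) = (fun w => T *m U *m X w).
    by apply/funext => w; rewrite mulmxA.
  apply: (iff_trans (isotropic_variance_conjecture mX isoX _ _)).
  rewrite opnorm2_mulmx_orthogonal// frobenius2_mulmx_orthogonal// EL.
  rewrite -!EFinM -!mulrA (mulrA C1) -/K /H /square_deviation /=.
  by under eq_integral do rewrite -mulmxA.
have goodE : good = O `&` [set U | (H U <= (7 * K)%:E)%E].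
  by apply/seteqP; split => U [oU] /(goodP U oU).
have mgood : measurable good.
  rewrite goodE; apply: emeasurable_fun_infty_c; first exact: mO.
  exact: measurable_funTS.
split=> //.
have intH : (\int[mu]_(U in O) H U <= (3 * K)%:E)%E.
  by rewrite haar_mean_deviation//; exact: isotropic_mean_deviation.
pose bad := O `&` [set U | ((7 * K)%:E <= `|H U|)%E].
have mbad : measurable bad.
  apply: emeasurable_fun_c_infty; first exact: mO.
  by apply: measurable_funTS; exact: measurableT_comp.
have K7 : 0 < 7 * K by lra.
have markovH : ((7 * K)%:E * mu bad <= (3 * K)%:E)%E.
  apply: le_trans intH; apply: le_trans (le_integral_abse mu mO _ K7) _.
    exact: measurable_funTS.
  by under eq_integral do rewrite gee0_abs//.
have cover : (1 <= mu good + mu bad)%E.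
  rewrite -(proj1 mu_haar).
  apply: le_trans (measureU2 _ mgood mbad).
  apply: le_measure; [apply/mem_set; exact: mO| |].
    by apply/mem_set; exact: measurableU.
  move=> U oU; rewrite goodE; have [hU|hU] := leP (H U) (7 * K)%:E.
    by left.
  by right; split=> //=; rewrite gee0_abs// ltW.
have gf : mu good \is a fin_num by exact: fin_num_measure.
have bf : mu bad \is a fin_num by exact: fin_num_measure.
move: markovH cover; rewrite -(fineK gf) -(fineK bf) -EFinM -EFinD !lee_fin lte_fin.
by move=> h1 h2; nra.
Qed.
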